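(* Let $n\geqslant 3$, $\lambda\in\mathbb{C}$, $\lambda\neq 0$, and let $\mathfrak{J}_\lambda^{n-1}$ be the $n$-dimensional complex Lie algebra with basis $e_1,\ldots,e_n$ and non-zero commutation relations \[ [e_1,e_n]=\lambda e_1,\qquad [e_k,e_n]=\lambda e_k+e_{k-1},\quad k=2,\ldots,n-1. \] Put $\xi_1=e_1$ and $\xi_k=\sum_{j=1}^k\frac{(-1)^{k-j}}{(k-j)!}e_1^{j-2}e_2^{k-j}e_j$ for $k=3,\ldots,n-1$. Then $\mathrm{Inv}(\mathfrak{J}_\lambda^{n-1})$ has a basis consisting of the $n-2$ generalized Casimir operators \[ \zeta_1=e_1\exp\Bigl(-\lambda\frac{e_2}{e_1}\Bigr),\qquad \zeta_k=\frac{\xi_k}{\xi_1^{k-1}},\quad k=3,\ldots,n-1. \]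
   Context: For a finite-dimensional Lie algebra $\mathfrak{g}$ with basis $e_1,\ldots,e_n$, $[e_i,e_j]=c_{ij}^ke_k$, let $x_1,\ldots,x_n$ be the coordinates on $\mathfrak{g}^*$ associated with the dual basis. An invariant of the coadjoint action is a (possibly only locally defined, on a connected open set) smooth (analytic in the complex case) function $F(x_1,\ldots,x_n)$ invariant under the coadjoint action, equivalently $\sum_{j,k}c_{ij}^kx_k\,\partial F/\partial x_j=0$ for all $i$. The maximal number of functionally independent invariants is $N_\mathfrak{g}=\dim\mathfrak{g}-\sup_x\operatorname{rank}(\sum_k c_{ij}^kx_k)_{i,j}$. A basis of invariants is a set of $N_\mathfrak{g}$ functionally independent invariants (every invariant is then locally a function of them). Elements of $\mathrm{Inv}(\mathfrak{g})$ (generalized Casimir operators) are obtained from invariants by replacing $x_i$ by $e_i$ (with symmetrization of non-commuting products); here only the mutually commuting elements $e_1,\ldots,e_{n-1}$ occur, so $e_i$ may simply be read as the coordinate $x_i$. *)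

(* Defs.v *)
From HB Require Import structures.
From mathcomp Require Import all_boot all_order all_algebra.
From mathcomp Require Import complex.
From mathcomp Require Import all_classical all_reals all_analysis.

Set Implicit Arguments.
Unset Strict Implicit.
Unset Printing Implicit Defensive.

Import Order.TTheory GRing.Theory Num.Theory.
Import numFieldNormedType.Exports.

Local Open Scope classical_set_scope.
Local Open Scope ring_scope.
Local Open Scope complex_scope.

(* The field R[i], packaged as a numClosedFieldType because the topology and
   the normed module structure of a field are attached to the latter. *)
Definition CC (R : realType) : numClosedFieldType := R[i].

(* exp(a + ib) = e^a (cos b + i sin b) *)
Definition expC (R : realType) (z : CC R) : CC R :=
  let: a +i* b := z in (expR a * cos b) +i* (expR a * sin b).

Record lieAlgebra (K : fieldType) (V : vectType K) := LieAlgebra {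
  lie_bracket :> V -> V -> V;
  lie_linearl : forall a x y z,
    lie_bracket (a *: x + y) z = a *: lie_bracket x z + lie_bracket y z;
  lie_linearr : forall a x y z,
    lie_bracket z (a *: x + y) = a *: lie_bracket z x + lie_bracket z y;
  lie_alternating : forall x, lie_bracket x x = 0;
  lie_jacobi : forall x y z,
    lie_bracket x (lie_bracket y z) + lie_bracket y (lie_bracket z x)
      + lie_bracket z (lie_bracket x y) = 0
}.

(* c_ij^k, where [e_i, e_j] = \sum_k c_ij^k e_k for a basis e of V *)
Definition structure_const (K : fieldType) (V : vectType K) (L : lieAlgebra V)
    (n : nat) (e : n.-tuple V) (i j k : 'I_n) : K :=
  coord e k (L e`_i e`_j).

(* The row vector x collects the coordinates of a point of the dual space with
   respect to the dual basis of e. *)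
Definition structure_mx (K : fieldType) (V : vectType K) (L : lieAlgebra V)
    (n : nat) (e : n.-tuple V) (x : 'rV[K]_n) : 'M[K]_n :=
  \matrix_(i, j) \sum_k structure_const L e i j k * x 0 k.

(* N = dim - sup_x rank; the supremum is a maximum over the finitely many
   possible values of the rank. *)
Definition num_invariants (K : fieldType) (V : vectType K) (L : lieAlgebra V)
    (n : nat) (e : n.-tuple V) : nat :=
  (n - \max_(r < n.+1 | `[< exists x, \rank (structure_mx L e x) = r >]) r)%N.

Section Invariants.
Variable R : realType.
Local Notation C := (CC R).

(* Differentiability is Frechet differentiability over the complex numbers, so
   that for open U this is analyticity on U. *)
Definition holomorphic_on (n : nat) (U : set 'rV[C]_n) (F : 'rV[C]_n -> C) :=
  forall x, U x -> differentiable F x.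

Definition invariant_on (V : vectType C) (L : lieAlgebra V) (n : nat)
    (e : n.-tuple V) (U : set 'rV[C]_n) (F : 'rV[C]_n -> C) :=
  [/\ open U, connected U, U !=set0, holomorphic_on U F &
    forall x, U x -> forall i : 'I_n,
      \sum_j \sum_k structure_const L e i j k * x 0 k
        * 'D_(delta_mx 0 j) F x = 0].

(* A functional relation on A is an analytic H, vanishing identically on no
   nonempty open subset of its domain, such that H(F_1, ..., F_m) = 0 on A. *)
Definition functional_relation (n m : nat) (A : set 'rV[C]_n)
    (F : 'I_m -> 'rV[C]_n -> C) (W : set 'rV[C]_m) (H : 'rV[C]_m -> C) :=
  [/\ open W, holomorphic_on W H,
      (forall W' : set 'rV[C]_m, open W' -> W' !=set0 -> W' `<=` W ->
         exists2 z, W' z & H z != 0) &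
      forall x, A x -> W (\row_i F i x) /\ H (\row_i F i x) = 0].

(* Independence: no relation holds on any nonempty open subset of U. *)
Definition functionally_independent (n m : nat) (U : set 'rV[C]_n)
    (F : 'I_m -> 'rV[C]_n -> C) :=
  forall A : set 'rV[C]_n, open A -> A !=set0 -> A `<=` U ->
    ~ exists W H, functional_relation A F W H.

Definition locally_function_of (n m : nat) (F : 'I_m -> 'rV[C]_n -> C)
    (G : 'rV[C]_n -> C) (p : 'rV[C]_n) :=
  exists (A : set 'rV[C]_n) (W : set 'rV[C]_m) (H : 'rV[C]_m -> C),
    [/\ open A, A p, open W, holomorphic_on W H &
      forall x, A x -> W (\row_i F i x) /\ G x = H (\row_i F i x)].

Definition basis_of_invariants (V : vectType C) (L : lieAlgebra V) (n : nat)
    (e : n.-tuple V) (U : set 'rV[C]_n) (m : nat)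
    (F : 'I_m -> 'rV[C]_n -> C) :=
  [/\ forall i, invariant_on L e U (F i),
      functionally_independent U F,
      m = num_invariants L e &
      forall U' G, invariant_on L e U' G ->
        forall p, U p -> U' p -> locally_function_of F G p].

(* x_k with k counted from 1; it is 0 when k > n. *)
Definition xcoord (n : nat) (x : 'rV[C]_n) (k : nat) : C :=
  oapp (x 0) 0 (insub k.-1).

(* The exponent j - 2 is an integer: it is -1 for j = 1. *)
Definition xi (n k : nat) (x : 'rV[C]_n) : C :=
  if k == 1%N then xcoord x 1 else
  \sum_(1 <= j < k.+1) (-1) ^+ (k - j) / ((k - j)`!)%:R
    * xcoord x 1 ^ (j%:Z - 2) * xcoord x 2 ^+ (k - j) * xcoord x j.

Definition zeta (lambda : C) (n k : nat) (x : 'rV[C]_n) : C :=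
  if k == 1%N then xcoord x 1 * expC (- lambda * (xcoord x 2 / xcoord x 1))
  else xi k x / xi 1 x ^+ k.-1.

(* The functions zeta_1, zeta_3, ..., zeta_(n-1), in this order *)
Definition zetas (lambda : C) (n : nat) (i : 'I_(n - 2)) : 'rV[C]_n -> C :=
  zeta lambda (if i == 0%N :> nat then 1%N else i.+2).

(* e is a basis of L with the commutation relations of J_lambda^(n-1); the
   vector e_k of the usual numbering is e`_k.-1. *)
Definition J_basis (lambda : C) (V : vectType C) (L : lieAlgebra V) (n : nat)
    (e : n.-tuple V) :=
  [/\ basis_of fullv e,
      L e`_0 e`_n.-1 = lambda *: e`_0,
      (forall k, (2 <= k <= n.-1)%N ->
         L e`_k.-1 e`_n.-1 = lambda *: e`_k.-1 + e`_k.-2) &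
      forall k l, (1 <= k <= n.-1)%N -> (1 <= l <= n.-1)%N ->
         L e`_k.-1 e`_l.-1 = 0].

End Invariants.

(* Main.v *)
Require Import Defs.
From HB Require Import structures.
From mathcomp Require Import all_boot all_order all_algebra.
From mathcomp Require Import complex.
From mathcomp Require Import all_classical all_reals all_analysis.
From mathcomp Require Import ring lra zify.
Import Order.TTheory GRing.Theory Num.Theory.
Import numFieldNormedType.Exports.
Local Open Scope classical_set_scope.
Local Open Scope ring_scope.

(* Invariance means that F does not depend on x_n and is annihilated by the
   linear vector field x |-> (lambda + N) x, N the shift e_k |-> e_(k-1).  Its
   flow exp(s (lambda + N)) is explicit; it translates the slope x_2 / x_1 by s,
   and the zetas are the coordinates of the point of an orbit with slope 0.
   So the zetas are invariant, and flowing this point by any slope t gives a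
   holomorphic section of x |-> (zeta_k x)_k.  Independence follows because the
   image of an open set contains an open set; an invariant G is constant along
   orbits, hence is locally (G o section) o zetas. *)

Set Implicit Arguments.
Unset Strict Implicit.
Unset Printing Implicit Defensive.

(** * The complex exponential: functional equation, surjectivity, derivative *)

Section ComplexExp.
Variable R : realType.
Local Open Scope complex_scope.
Local Notation C := (CC R).
Local Notation Re := (@complex.Re R).
Local Notation Im := (@complex.Im R).

Lemma normc_le_ReIm (z : C) : `|z| <= (`|Re z| + `|Im z|)%:C.
Proof.
rewrite {1}(complexE z); apply: le_trans (ler_normD _ _) _.
rewrite rmorphD normrM lerD//=.
  by rewrite normc_def /= expr0n addr0 sqrtr_sqr.
rewrite [X in X * _]normc_def /= expr0n add0r expr1n sqrtr1 mul1r.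
by rewrite normc_def /= expr0n addr0 sqrtr_sqr.
Qed.

Lemma normc_ge_Im (z : C) : `|Im z|%:C <= `|z|.
Proof.
rewrite normc_def lecR -sqrtr_sqr ler_wsqrtr// lerDr sqr_ge0//.
Qed.

Lemma Re_continuous : continuous (fun z : C => Re z : R).
Proof.
move=> z; apply/(@cvgrPdist_lt _ _ _ (nbhs z)) => e e0.
have : \forall t \near z, `|z - t| < e%:C :> C.
  by apply: (@nbhsx_ballx C C z e%:C); rewrite ltcR.
apply: filterS => t zt; rewrite -ltcR; apply: le_lt_trans zt.
have -> : Re z - Re t = Re (z - t) by case: z => ? ?; case: t.
exact: normc_ge_Re.
Qed.

Lemma Im_continuous : continuous (fun z : C => Im z : R).
Proof.
move=> z; apply/(@cvgrPdist_lt _ _ _ (nbhs z)) => e e0.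
have : \forall t \near z, `|z - t| < e%:C :> C.
  by apply: (@nbhsx_ballx C C z e%:C); rewrite ltcR.
apply: filterS => t zt; rewrite -ltcR; apply: le_lt_trans zt.
have -> : Im z - Im t = Im (z - t) by case: z => ? ?; case: t.
exact: normc_ge_Im.
Qed.

Lemma real_complex_continuous : continuous (fun x : R => x%:C : C).
Proof.
move=> x; apply/cvgrPdist_lt => e e0.
(* A positive element of [C] is real, so the complex tolerance [e] may be replaced by its real
   part. *)
have er : (Re e)%:C = e by rewrite RRe_real// gtr0_real.
have er0 : 0 < Re e by rewrite -ltcR er.
have : \forall t \near x, `|x - t| < Re e.
  by apply: (@nbhsx_ballx _ R x (Re e)).
apply: filterS => t xt.
rewrite -(rmorphB (real_complex R)) normc_def /= expr0n addr0 sqrtr_sqr -er.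
by rewrite ltcR.
Qed.

Lemma expC0 : expC 0 = 1 :> C.
Proof. by rewrite /expC /= expR0 cos0 sin0 mulr1 mulr0. Qed.

Lemma expCD (x y : C) : expC (x + y) = expC x * expC y.
Proof.
case: x y => a b [c d]; rewrite /expC /=.
rewrite expRD cosD sinD; apply/eqP; rewrite eq_complex /=.
by apply/andP; split; apply/eqP; ring.
Qed.

Lemma expC_neq0 (x : C) : expC x != 0.
Proof.
apply/eqP => x0; have := expCD x (- x); rewrite subrr expC0 x0 mul0r.
by move/eqP; rewrite oner_eq0.
Qed.

(** Polar coordinates: the argument is [acos (Re w / r)] up to sign, and since [sin (acos a)] is
    [|b|] the sign is that of [Im w]. *)
Lemma expC_surj (w : C) : w != 0 -> exists z, expC z = w.
Proof.
move=> w0.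
pose r := Num.sqrt ((Re w)^+2 + (Im w)^+2).
have rE : `|w| = r%:C by rewrite normc_def.
have r0 : 0 < r by rewrite -ltcR -rE normr_gt0.
have r2 : r ^+ 2 = (Re w)^+2 + (Im w)^+2.
  by rewrite sqr_sqrtr// addr_ge0// sqr_ge0.
pose a := Re w / r; pose b := Im w / r.
have ab : a ^+ 2 + b ^+ 2 = 1.
  by rewrite /a /b !expr_div_n -mulrDl -r2 divff// expf_neq0// gt_eqF.
have a1 : -1 <= a <= 1.
  rewrite -ler_norml -(@ler_pXn2r _ 2)// ?nnegrE// real_normK ?num_real//.
  by rewrite expr1n -ab lerDl sqr_ge0.
have sa : sin (acos a) = `|b|.
  by rewrite sin_acos// -ab addrAC subrr add0r sqrtr_sqr.
have ca : cos (acos a) = a by rewrite acosK// in_itv.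
exists ((ln r) +i* (if 0 <= b then acos a else - acos a)).
have rw : w = (r * a) +i* (r * b).
  by rewrite /a /b; case: (w) => x y /=; rewrite !(mulrC r) !divfK ?gt_eqF.
rewrite /expC lnK ?posrE// [RHS]rw; case: ifPn => b0.
  by rewrite ca sa ger0_norm.
by rewrite cosN sinN ca sa ltr0_norm ?opprK// ltNge.
Qed.

(** The limit of difference quotients, multiplied through by [h], so that the estimate holds on a
    full neighbourhood including [h = 0]. *)
Lemma is_derive_near_affine (f : R -> R) (df : R) : is_derive (0:R) 1 f df ->
  forall e, 0 < e -> \forall h \near (0:R), `|f h - f 0 - h * df| <= e * `|h|.
Proof.
move=> [fd fE] e e0.
have : (fun h : R => h^-1 *: ((f \o shift 0) (h *: (1:R)) - f 0)) @ 0^' --> df.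
  by rewrite -fE; exact: fd.
move=> /cvgrPdist_le /(_ e e0).
move=> H.
have : \forall h \near (0:R), h != 0 -> `|df - h^-1 *: (f (h *: 1 + 0) - f 0)| <= e.
  exact: H.
apply: filterS => h hh.
have [->|h0] := eqVneq h 0; first by rewrite subrr mul0r subr0 normr0 mulr0.
move: (hh h0); rewrite addr0 scaler1 => h1.
have -> : f h - f 0 - h * df = - (df - h^-1 *: (f h - f 0)) * h.
  by rewrite /GRing.scale /=; field.
by rewrite normrM normrN ler_wpM2r.
Qed.

(** With [h = a + ib] and [expR a <= 2], the real and the imaginary part of the error are each at
    most [3 * d * |h|]: twice [d] from the trigonometric error, once [d] from [expR]. *)
Lemma expC_affine_bound (d : R) (h : C) : 0 < d ->
  `|expR (Re h) - expR 0 - Re h * expR 0| <= d * `|Re h| ->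
  `|expR 0 - expR (Re h)| < Num.min d 1 ->
  `|cos (Im h) - cos 0 - Im h * - sin 0| <= d * `|Im h| ->
  `|sin (Im h) - sin 0 - Im h * cos 0| <= d * `|Im h| ->
  `|expC h - 1 - h| <= (6 * d)%:C * `|h|.
Proof.
move=> d0.
have hRe : `|Re h|%:C <= `|h| by exact: normc_ge_Re.
have hIm := normc_ge_Im h.
case: h hRe hIm => a b /=.
rewrite expR0 cos0 sin0 oppr0 !(mulr0, mulr1, subr0, addr0) lt_min.
move=> hRe hIm expa /andP[exp1a exp2a] cosb sinb.
apply: le_trans (normc_le_ReIm _) _.
have er : `|(a +i* b : C)| = (complex.Re `|(a +i* b : C)|)%:C.
  by rewrite RRe_real// normr_real.
move: hRe hIm; rewrite er -(rmorphM (real_complex R)) !lecR.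
set r := complex.Re _ => ar br /=.
have exp2 : expR a <= 2 by move: exp2a; rewrite ltr_norml => /andP[]; lra.
have -> : expR a * cos b - 1 - a = expR a * (cos b - 1) + (expR a - 1 - a) by ring.
have -> : expR a * sin b - 0 - b = expR a * (sin b - b) - (1 - expR a) * b by ring.
have t1 : `|expR a * (cos b - 1)| <= 2 * (d * `|b|).
  by rewrite normrM (ger0_norm (expR_ge0 a)) ler_pM.
have t2 : `|expR a * (sin b - b)| <= 2 * (d * `|b|).
  by rewrite normrM (ger0_norm (expR_ge0 a)) ler_pM.
have t3 : `|(1 - expR a) * b| <= d * `|b|.
  by rewrite normrM ler_wpM2r// ltW.
have u1 := ler_normD (expR a * (cos b - 1)) (expR a - 1 - a).
have u2 := ler_normB (expR a * (sin b - b)) ((1 - expR a) * b).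
have v1 : d * `|a| <= d * r by rewrite ler_pM2l.
have v2 : d * `|b| <= d * r by rewrite ler_pM2l.
have -> : 6 * d * r = 6 * (d * r) by ring.
lra.
Qed.

Lemma expC_near_affine (e : R) : 0 < e ->
  \forall h \near (0:C), `|expC h - 1 - h| <= e%:C * `|h|.
Proof.
move=> e0; pose d := e / 6%:R; have d0 : 0 < d by rewrite divr_gt0.
have expA := is_derive_near_affine (is_derive_expR 0) d0.
have cosA := is_derive_near_affine (is_derive_cos 0) d0.
have sinA := is_derive_near_affine (is_derive_sin 0) d0.
have exp1 : \forall a \near (0:R), `|expR 0 - expR a| < Num.min d 1.
  have /cvgrPdist_lt := @continuous_expR R 0; apply.
  by rewrite lt_min d0 ltr01.
have cRe : (fun z : C => Re z : R) @ (0 : C) --> (0 : R) := @Re_continuous 0.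
have cIm : (fun z : C => Im z : R) @ (0 : C) --> (0 : R) := @Im_continuous 0.
have e6 : e = 6 * d by rewrite /d; field.
near=> h; rewrite e6; apply: expC_affine_bound => //; near: h.
- exact: cRe expA.
- exact: cRe exp1.
- exact: cIm cosA.
- exact: cIm sinA.
Unshelve. all: by end_near. Qed.

(** The functional equation reduces this to the derivative at 0; the error is scaled by [|expC z|],
    hence the tolerance [e / |expC z|] there. *)
Global Instance is_derive_expC (z : C) : is_derive z 1 (@expC R : C -> C) (expC z).
Proof.
have H : (fun h : C => h^-1 *: (((@expC R : C -> C) \o shift z) (h *: (1:C)) - expC z) : C)
    @ (0:C)^' --> (expC z : C).
  apply/(@cvgrPdist_le C C _ ((0:C)^')) => e e0.
  have er : (Re e)%:C = e by rewrite RRe_real// gtr0_real.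
  have er0 : 0 < Re e by rewrite -ltcR er.
  have zr : (Re `|expC z|)%:C = `|expC z| by rewrite RRe_real// normr_real.
  have z0 : 0 < Re `|expC z| by rewrite -ltcR zr normr_gt0 expC_neq0.
  have H := expC_near_affine (divr_gt0 er0 z0).
  have H0 : \forall h \near (0:C)^', h != 0 by exact: (@nbhs_dnbhs_neq C 0).
  have H1 : \forall h \near (0:C)^', `|expC h - 1 - h| <= (Re e / Re `|expC z|)%:C * `|h|.
    by apply: (@nbhs_dnbhs C 0).
  apply: filterS2 H0 H1 => h h0 {}H /=.
  rewrite scaler1 expCD /GRing.scale /=.
  have -> : expC z - h^-1 * (expC h * expC z - expC z) =
    - (expC z * (expC h - 1 - h) * h^-1) by field.
  rewrite normrN !normrM normfV ler_pdivrMr ?normr_gt0//.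
  apply: le_trans (ler_wpM2l (normr_ge0 _) H) _.
  by rewrite -{1}zr mulrA -(rmorphM (real_complex R)) mulrCA divff ?gt_eqF// mulr1 -[in leRHS]er.
split; first exact: cvgP H.
exact/cvg_lim.
Qed.

End ComplexExp.

(** * Zero derivative on a real segment, differentiability of rows, connectedness *)

Section MoreAnalysis.
Variable R : realType.
Local Open Scope complex_scope.
Local Notation C := (CC R).
Local Notation Re := (@complex.Re R).
Local Notation Im := (@complex.Im R).

(** [P] stands for [Re] or [Im]: a continuous real-linear map commutes with difference quotients
    taken along real increments. *)
Lemma is_derive_real_part (P : C -> R) (g : C -> C) (r : R) :
  continuous P -> {morph P : x y / x - y} ->
  (forall (a : R) z, P (a%:C * z) = a * P z) ->
  is_derive (r%:C : C) 1 g 0 -> is_derive r 1 (fun t : R => P (g (t%:C))) 0.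
Proof.
move=> Pc PB PZ [gd gE].
have P0 : P 0 = 0 by rewrite -[X in P X](mul0r 0) -[X in X * _](rmorph0 (real_complex R)) PZ mul0r.
have H : (fun h : C => h^-1 *: ((g \o shift (r%:C : C)) (h *: (1:C)) - g r%:C) : C)
    @ (0:C)^' --> (0 : C).
  by rewrite -[X in _ --> X]gE; exact: gd.
have rc : (fun h : R => h%:C : C) @ (0:R)^' --> (0:C)^'.
  move=> U U0; have U1 : nbhs (0 : C) (fun y => y != 0 -> U y) := U0.
  change (nbhs (0 : R) (fun h : R => h != 0 -> U (h%:C : C))).
  have W : nbhs (0 : R) (fun h : R => (h%:C : C) != 0 -> U (h%:C : C)).
    exact: (@real_complex_continuous R 0 _ U1).
  apply: filterS W => h hU h0.
  by apply: hU; rewrite eq_complex /= eqxx andbT.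
have K := cvg_comp _ _ (cvg_comp _ _ rc H) (Pc 0).
rewrite P0 in K.
have {K} : (fun h : R => h^-1 *: (((fun t : R => P (g (t%:C))) \o shift r) (h *: (1:R)) - P (g r%:C)) : R)
    @ (0:R)^' --> (0:R).
  apply: cvg_trans K; apply: near_eq_cvg; near=> h => /=.
  rewrite /GRing.scale /= !mulr1 -PB -PZ; congr (P (_ * (g _ - _))).
    by rewrite (fmorphV (real_complex R)).
  by rewrite (rmorphD (real_complex R)).
by move=> K; split; [exact: cvgP K | exact/cvg_lim].
Unshelve. all: by end_near. Qed.

Lemma derive0_eq01 (f : R -> R) :
  (forall r : R, 0 <= r <= 1 -> is_derive r 1 f 0) -> f 1 = f 0.
Proof.
move=> fd.
have [||c _] := @MVT_segment R f (fun=> 0) 0 1 ler01.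
- by move=> x; rewrite in_itv /= => /andP[x0 x1]; apply: fd; rewrite !ltW.
- apply: continuous_in_subspaceT => x; rewrite inE /= in_itv /= => x01.
  have [fx _] := fd x x01.
  exact/differentiable_continuous/derivable1_diffP.
by rewrite mul0r => /eqP; rewrite subr_eq0 => /eqP.
Qed.

(** The mean value theorem is real, so it is applied to [Re] and [Im] separately, along the real
    segment from 0 to 1. *)
Lemma complex_derive0_eq01 (g : C -> C) :
  (forall r : R, 0 <= r <= 1 -> is_derive (r%:C : C) 1 g 0) -> g 1 = g 0.
Proof.
move=> gd.
have rE : Re (g 1) = Re (g 0).
  apply: (@derive0_eq01 (fun t : R => Re (g t%:C))) => r /gd.
  apply: is_derive_real_part; first exact: Re_continuous.
    by move=> [? ?] [? ?].
  by move=> a [? ?] /=; rewrite mul0r subr0.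
have iE : Im (g 1) = Im (g 0).
  apply: (@derive0_eq01 (fun t : R => Im (g t%:C))) => r /gd.
  apply: is_derive_real_part; first exact: Im_continuous.
    by move=> [? ?] [? ?].
  by move=> a [? ?] /=; rewrite mul0r addr0.
by apply/eqP; rewrite eq_complex rE iE !eqxx.
Qed.

Lemma row_fun_sum (K : pzRingType) (T : Type) (n : nat) (f : 'I_n -> T -> K) :
  (fun v => \row_i f i v) = \sum_(i < n) (fun v => f i v *: delta_mx 0 i).
Proof.
apply/funext => v; rewrite fct_sumE [LHS]row_sum_delta.
by apply: eq_bigr => i _; rewrite mxE.
Qed.

Lemma differentiable_row (K : numFieldType) (V : normedModType K) (n : nat)
    (f : 'I_n -> V -> K) (x : V) :
  (forall i, differentiable (f i) x) ->
  differentiable (fun v => \row_i f i v : 'rV[K]_n) x.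
Proof.
move=> fd.
rewrite row_fun_sum; apply: differentiable_sum => i; exact: differentiableZl.
Qed.

(** The space is the union of the segments from the origin to its points. *)
Lemma connected_rV (n : nat) : connected [set: 'rV[C]_n].
Proof.
have -> : [set: 'rV[C]_n] = \bigcup_(x in [set: 'rV[C]_n])
    ((fun t : R => (t%:C : C) *: x) @` `[0, 1]).
  rewrite eqEsubset; split => // x _; exists x => //; exists 1.
    by rewrite /= in_itv /= ler01 lexx.
  by rewrite scale1r.
apply: bigcup_connected.
  exists 0 => x _; exists 0; first by rewrite /= in_itv /= ler01 lexx.
  by rewrite scale0r.
move=> x _; apply: connected_continuous_connected; first exact: segment_connected.
apply: continuous_subspaceT => t.
apply: cvgZr_tmp; exact: real_complex_continuous.
Qed.

End MoreAnalysis.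

(** * The exponential of the nilpotent shift *)

Section TruncatedExp.
Variable K : numFieldType.

(** Component [k] of [exp(s N) y], where [N] sends the sequence [y] to [k |-> y (k - 1)], with 0 at
    [k = 0]; indices start at 0. *)
Definition texp (s : K) (y : nat -> K) (k : nat) : K :=
  \sum_(j < k.+1) s ^+ (k - j) / (k - j)`!%:R * y j.

Lemma eq_texp s (y z : nat -> K) k :
  (forall j, (j <= k)%N -> y j = z j) -> texp s y k = texp s z k.
Proof. by move=> yz; apply: eq_bigr => j _; rewrite yz// -ltnS. Qed.

Lemma texpZ s a (y : nat -> K) k : texp s (fun j => a * y j) k = a * texp s y k.
Proof. by rewrite /texp mulr_sumr; apply: eq_bigr => j _; rewrite mulrCA. Qed.

Lemma texp0 (y : nat -> K) k : texp 0 y k = y k.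
Proof.
rewrite /texp big_ord_recr /= subnn expr0 divr1 mul1r big1 ?add0r// => j _.
by rewrite expr0n subn_eq0 leqNgt ltn_ord !mul0r.
Qed.

(** Under generating polynomials [N] becomes multiplication by [X], so [exp(s N)] becomes
    multiplication by the truncated series of [exp(s X)]. *)
Lemma texp_coef N s (y : nat -> K) k : (k < N)%N ->
  texp s y k = ((\poly_(i < N) (s ^+ i / i`!%:R)) * (\poly_(i < N) y i))`_k.
Proof.
move=> kN; rewrite coefMr; apply: eq_bigr => j _.
rewrite !coef_poly (leq_ltn_trans (leq_subr _ _) kN).
by rewrite (leq_ltn_trans _ kN)// -ltnS.
Qed.

Lemma expK_coefD N (s t : K) k : (k < N)%N ->
  ((\poly_(i < N) (s ^+ i / i`!%:R)) * (\poly_(i < N) (t ^+ i / i`!%:R)))`_k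
  = (s + t) ^+ k / k`!%:R.
Proof.
move=> kN; rewrite coefMr exprDn mulr_suml; apply: eq_bigr => j _.
have jk : (j <= k)%N by rewrite -ltnS.
rewrite !coef_poly (leq_ltn_trans (leq_subr _ _) kN) (leq_ltn_trans jk kN).
have F m : (m`!%:R : K) != 0 by rewrite pnatr_eq0 -lt0n fact_gt0.
rewrite -(bin_fact jk) !natrM -[in RHS]mulr_natr.
have B : ('C(k, j)%:R : K) != 0 by rewrite pnatr_eq0 -lt0n bin_gt0.
by field; rewrite !F B.
Qed.

(** Associativity of the polynomial product, together with [exp(s X) exp(t X) = exp((s + t) X)] up
    to degree [k]. *)
Lemma texpD s t (y : nat -> K) k : texp s (texp t y) k = texp (s + t) y k.
Proof.
rewrite !(@texp_coef k.+1)//.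
(* Coefficient [k] of a product only sees coefficients of index at most [k], so truncating the
   factors is harmless. *)
have E : forall p q r : {poly K},
    (forall i, (i < k.+1)%N -> p`_i = q`_i) -> (r * p)`_k = (r * q)`_k.
  move=> p q r pq; rewrite !coefMr; apply: eq_bigr => j _.
  by rewrite pq.
rewrite (E _ ((\poly_(i < k.+1) (t ^+ i / i`!%:R)) * (\poly_(i < k.+1) y i))).
  rewrite mulrA mulrC [in RHS]mulrC; apply: E => i ik.
  by rewrite expK_coefD// coef_poly ik.
by move=> i ik; rewrite coef_poly ik (@texp_coef k.+1).
Qed.

Lemma differentiable_exp (V : normedModType K) (a : V -> K) k v :
  differentiable a v -> differentiable (fun w => a w ^+ k) v.
Proof.
move=> da; have -> : (fun w => a w ^+ k) = a ^+ k.
  by apply/funext => w; rewrite exprfctE.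
by case: k => [|k]; [exact: differentiable_cst | exact: differentiableX].
Qed.

Lemma differentiable_texp (V : normedModType K) (a : V -> K) (b : nat -> V -> K) k v :
  differentiable a v -> (forall j, differentiable (b j) v) ->
  differentiable (fun w => texp (a w) (fun j => b j w) k) v.
Proof.
move=> da db.
have -> : (fun w => texp (a w) (fun j => b j w) k) =
    \sum_(j < k.+1) (fun w => a w ^+ (k - j) / (k - j)`!%:R * b j w).
  by apply/funext => w; rewrite fct_sumE.
apply: differentiable_sum => j.
apply: differentiableM => //; apply: differentiableM => //.
exact: differentiable_exp.
Qed.

(** The derivative of [exp(s N)] is [N exp(s N)], and [N] lowers the index, giving 0 at index 0. *)
Lemma is_derive_texp (s : K) (y : nat -> K) k :
  is_derive s 1 (fun t => texp t y k) (if k is k'.+1 then texp s y k' else 0).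
Proof.
case: k => [|k].
  have -> : (fun t => texp t y 0) = cst (y 0%N).
    by apply/funext => t; rewrite /texp big_ord_recr big_ord0 /= expr0 divr1 mul1r add0r.
  exact: is_derive_cst.
have -> : (fun t => texp t y k.+1) = \sum_(j < k.+1)
    (((k.+1 - j)`!%:R)^-1 * y j \*: (fun t : K => t ^+ (k.+1 - j))) + cst (y k.+1).
  apply/funext => t; rewrite /texp big_ord_recr /= subnn expr0 divr1 mul1r.
  rewrite [RHS]/GRing.add /= fct_sumE; congr (_ + _); apply: eq_bigr => j _.
  by rewrite /GRing.scale /= -mulrA mulrC.
rewrite -[texp s y k]addr0; apply: is_deriveD.
apply: is_derive_sum => j.
have jk : (j <= k)%N by rewrite -ltnS.
rewrite subSn//.
have E : is_derive s 1 (fun t : K => t ^+ (k - j).+1) ((k - j).+1%:R * s ^+ (k - j)).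
  split; first exact: exprn_derivable.
  by rewrite exp_derive /GRing.scale /= mulr1.
apply: is_derive_eq; rewrite factS natrM /GRing.scale /=.
have F m : (m`!%:R : K) != 0 by rewrite pnatr_eq0 -lt0n fact_gt0.
have : ((k - j).+1%:R : K) != 0 by rewrite pnatr_eq0.
by move: (k - j).+1%:R => c c0; field; rewrite F c0.
Qed.

End TruncatedExp.

(** * Chain rules and derivatives of curves *)

Section OneVariable.
Variable K : numFieldType.

Lemma is_derive_comp1 (f g : K -> K) (t df dg : K) :
  is_derive t 1 g dg -> is_derive (g t) 1 f df ->
  is_derive t 1 (f \o g) (df * dg).
Proof.
move=> [gd <-] [fd <-].
have gd' : differentiable g t by exact/derivable1_diffP.
have fd' : differentiable f (g t) by exact/derivable1_diffP.
split; first by apply/derivable1_diffP; exact: differentiable_comp.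
rewrite deriveE; last exact: differentiable_comp.
have fE h : ('d f (g t) : K -> K) h = h * 'D_1 f (g t) by rewrite (deriv1E fd) derive1E.
by rewrite diff_comp//= fE -deriveE// mulrC.
Qed.

Lemma derive_curve (V W : normedModType K) (f : V -> W) (g : K -> V) (t : K) :
  derivable g t 1 -> differentiable f (g t) ->
  is_derive t 1 (f \o g) ('d f (g t) ('D_1 g t)).
Proof.
move=> gd fd.
have gd' : differentiable g t by exact/derivable1_diffP.
have fg : differentiable (f \o g) t by exact: differentiable_comp.
split; first exact/derivable1_diffP.
by rewrite deriveE// [in RHS]deriveE// diff_comp.
Qed.

Lemma is_derive_row (n : nat) (f : 'I_n -> K -> K) (df : 'I_n -> K) (t : K) :
  (forall i, is_derive t 1 (f i) (df i)) ->
  is_derive t 1 (fun z => \row_i f i z : 'rV[K]_n) (\row_i df i).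
Proof.
move=> fd.
rewrite row_fun_sum.
rewrite [X in is_derive _ _ _ X]row_sum_delta.
apply: is_derive_sum => i; rewrite mxE; case: (fd i) => fid fiE.
have fid' : differentiable (f i) t by exact/derivable1_diffP.
have dZ : differentiable (fun v => f i v *: (delta_mx 0 i : 'rV[K]_n)) t.
  exact: differentiableZl.
split; first exact/derivable1_diffP.
by rewrite deriveE// diffZl//= -deriveE// fiE.
Qed.

End OneVariable.

(** * The flow of the linear vector field *)

Section Flow.
Variable R : realType.
Local Open Scope complex_scope.
Local Notation C := (CC R).

Lemma differentiable_expC (z : C) : differentiable (@expC R : C -> C) z.
Proof. by apply/derivable1_diffP; case: (is_derive_expC z). Qed.

Lemma xcoordS n (x : 'rV[C]_n) (i : 'I_n) : xcoord x i.+1 = x 0 i.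
Proof. by rewrite /xcoord /= valK. Qed.

Lemma differentiable_xcoord n k (x : 'rV[C]_n) : differentiable (fun y => xcoord y k) x.
Proof.
rewrite /xcoord; case: insubP => [i _ _ /=|_]; first exact: differentiable_coord.
exact: differentiable_cst.
Qed.

Variable lambda : C.

(* The first n - 1 coordinates follow exp(s (lambda + N)), where N is the shift
   e_k |-> e_(k-1); the last coordinate, along which invariants are constant,
   is set to u. *)
Definition flow n (s u : C) (x : 'rV[C]_n) : 'rV[C]_n :=
  \row_(k < n) if (k < n.-1)%N
    then expC (lambda * s) * texp s (fun j => xcoord x j.+1) k else u.

(** The vector field [(lambda + N) x]. As [k] counts from 0 and [xcoord] from 1, [xcoord x k] is the
    preceding coordinate; [k = 0] is set apart because [xcoord x 0] equals [xcoord x 1] rather than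
    0. *)
Definition flow_field n (x : 'rV[C]_n) : 'rV[C]_n :=
  \row_(k < n) if (k < n.-1)%N
    then lambda * xcoord x k.+1 + (if k == 0%N :> nat then 0 else xcoord x k) else 0.

Lemma xcoord_flow n s u (x : 'rV[C]_n) k : (k < n.-1)%N ->
  xcoord (flow s u x) k.+1 = expC (lambda * s) * texp s (fun j => xcoord x j.+1) k.
Proof.
move=> kn; have kn' : (k < n)%N by lia.
by rewrite (@xcoordS n _ (Ordinal kn')) mxE /= kn.
Qed.

Lemma eq_flow n s u (x y : 'rV[C]_n) :
  (forall k, (k < n.-1)%N -> xcoord x k.+1 = xcoord y k.+1) ->
  flow s u x = flow s u y.
Proof.
move=> xy; apply/rowP => k; rewrite !mxE; case: ifP => // kn.
by congr (_ * _); apply: eq_texp => j jk; apply: xy; apply: leq_ltn_trans kn.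
Qed.

(** The scalar factors combine by [expCD] and the shifts by [texpD]; the outer flow overwrites the
    last coordinate, so only [u] survives. *)
Lemma flowD n s t u v (x : 'rV[C]_n) : flow s u (flow t v x) = flow (s + t) u x.
Proof.
apply/rowP => k; rewrite !mxE; case: ifP => // kn.
rewrite mulrDr expCD -mulrA -texpD; congr (_ * _).
rewrite -texpZ; apply: eq_texp => j jk.
by rewrite xcoord_flow//; apply: leq_ltn_trans kn.
Qed.

Lemma differentiable_flow n (V : normedModType C) (a b : V -> C) (c : V -> 'rV[C]_n) v :
  differentiable a v -> differentiable b v -> differentiable c v ->
  differentiable (fun w => flow (a w) (b w) (c w)) v.
Proof.
move=> da db dc; apply: differentiable_row => k; case kn : (k < n.-1)%N => //.
apply: differentiableM.
  apply: (@differentiable_comp _ _ _ _ (fun w => lambda * a w) (@expC R : C -> C)).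
    exact: differentiableM.
  exact: differentiable_expC.
apply: differentiable_texp => // j.
apply: (@differentiable_comp _ _ _ _ c (fun y => xcoord y j.+1)) => //.
exact: differentiable_xcoord.
Qed.

(** Time and last coordinate move together along a straight line of direction [(h, w)]; these curves
    realise both vectors that an invariant must annihilate. *)
Lemma is_derive_flow n (h u w : C) (x : 'rV[C]_n.+1) (t : C) :
  is_derive t 1 (fun z => flow (z * h) (u + z * w) x)
    (h *: flow_field (flow (t * h) (u + t * w) x) + w *: delta_mx 0 ord_max).
Proof.
have -> : h *: flow_field (flow (t * h) (u + t * w) x) + w *: delta_mx 0 ord_max =
  \row_(k < n.+1) if (k < n)%N then
     h * (lambda * xcoord (flow (t * h) (u + t * w) x) k.+1 +
       (if k == 0%N :> nat then 0 else xcoord (flow (t * h) (u + t * w) x) k)) else w.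
  apply/rowP => k; rewrite !mxE eqxx /=; case: ifP => kn.
    rewrite -val_eqE /= (ltn_eqF kn) mulr0 addr0//.
  have -> : k = ord_max by apply/val_inj => /=; have := ltn_ord k; lia.
  by rewrite eqxx mulr0 mulr1 add0r.
apply: is_derive_row => k; rewrite /=; case kn : (k < n)%N; last first.
  by apply: is_derive_eq; rewrite /GRing.scale /=; ring.
have h1 : is_derive t 1 (fun z : C => z * h) h.
  by apply: is_derive_eq; rewrite /GRing.scale /=; ring.
have h2 : is_derive t 1 (fun z : C => lambda * (z * h)) (lambda * h).
  by apply: is_derive_eq; rewrite /GRing.scale /=; ring.
have d1 : is_derive t 1 (fun z : C => expC (lambda * (z * h)) : C)
    (expC (lambda * (t * h)) * (lambda * h)).
  exact: (is_derive_comp1 h2 (is_derive_expC _)).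
have d2 := is_derive_comp1 h1 (is_derive_texp (t * h) (fun j => xcoord x j.+1) k).
apply: (is_derive_eq (is_deriveM d1 d2)).
rewrite xcoord_flow// /GRing.scale /=.
case: (nat_of_ord k) kn => [|k'] kn /=; first by ring.
rewrite xcoord_flow ?(ltn_trans _ kn)//; ring.
Qed.

End Flow.

(** * The structure matrix, the invariance equations and the number of invariants *)

Section Structure.
Variables (R : realType) (n : nat) (lambda : CC R).
Variables (V : vectType (CC R)) (L : lieAlgebra V) (e : n.+1.-tuple V).
Local Open Scope complex_scope.
Local Notation C := (CC R).
Hypotheses (n2 : (2 <= n)%N) (eJ : J_basis lambda L e).

Lemma lie_antisym (x y : V) : L x y = - L y x.
Proof.
have DL a b c : L (a + b) c = L a c + L b c.
  by have := lie_linearl L 1 a b c; rewrite !scale1r.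
have DR a b c : L c (a + b) = L c a + L c b.
  by have := lie_linearr L 1 a b c; rewrite !scale1r.
have := lie_alternating L (x + y).
rewrite DL !DR !lie_alternating add0r addr0 => /eqP.
by rewrite addr_eq0 => /eqP.
Qed.

(** The point [x] of the dual space as a linear form on [V]; its values on brackets of basis vectors
    are the entries of [structure_mx]. *)
Definition coord_form (x : 'rV[C]_n.+1) (v : V) : C := \sum_k coord e k v * x 0 k.

Lemma coord_formZD x a v w :
  coord_form x (a *: v + w) = a * coord_form x v + coord_form x w.
Proof.
rewrite /coord_form mulr_sumr -big_split; apply: eq_bigr => k _ /=.
by rewrite linearP /= mulrDl mulrA.
Qed.

Lemma coord_form0 x : coord_form x 0 = 0.
Proof. by rewrite /coord_form big1// => k _; rewrite linear0 mul0r. Qed.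

Lemma coord_formN x v : coord_form x (- v) = - coord_form x v.
Proof. by have := coord_formZD x (-1) v 0; rewrite scaleN1r addr0 coord_form0 addr0 mulN1r. Qed.

Lemma coord_form_basis x k : (k < n.+1)%N -> coord_form x e`_k = xcoord x k.+1.
Proof.
move=> kn; have [eb _ _ _] := eJ.
rewrite (@xcoordS _ _ _ (Ordinal kn)) /coord_form (bigD1 (Ordinal kn))//=.
rewrite (coord_free (Ordinal kn)) ?(basis_free eb)// eqxx mul1r big1 ?addr0//.
move=> i ik; rewrite (coord_free (Ordinal kn)) ?(basis_free eb)//.
by rewrite eq_sym (negbTE ik) mul0r.
Qed.

Lemma coord_form_bracket x k : (k < n)%N ->
  coord_form x (L e`_k e`_n) =
    lambda * xcoord x k.+1 + (if k == 0%N then 0 else xcoord x k).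
Proof.
have [_ e0 ek _] := eJ; case: k => [|k] kn /=.
  rewrite /= in e0; rewrite e0 addr0 -[_ *: _]addr0 coord_formZD coord_form0 addr0.
  by rewrite coord_form_basis.
have /= -> := ek k.+2 _; last by lia.
by rewrite coord_formZD !coord_form_basis//; lia.
Qed.

(** Only brackets with [e_n] are non-zero, so the matrix lives on its last row and column; both are
    given by [flow_field], with opposite signs. *)
Lemma structure_mxE x : structure_mx L e x =
  (flow_field lambda x)^T *m delta_mx 0 ord_max
    - (delta_mx 0 ord_max)^T *m flow_field lambda x.
Proof.
apply/matrixP => i j; rewrite !mxE !big_ord1 !mxE eqxx /=.
rewrite -[LHS]/(coord_form x (L e`_i e`_j)).
have maxE (k : 'I_n.+1) : (k == ord_max) = ~~ (k < n)%N.
  by rewrite -val_eqE /= -leqNgt eqn_leq -ltnS ltn_ord.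
rewrite !maxE.
have gen (k : 'I_n.+1) : ~~ (k < n)%N -> nat_of_ord k = n.
  by rewrite -maxE => /eqP ->.
have [_ _ _ e00] := eJ.
case: (boolP (i < n)%N) => iN; case: (boolP (j < n)%N) => jN.
- have /= -> := e00 i.+1 j.+1 iN jN; rewrite coord_form0.
  by rewrite mulr0 mul0r subr0.
- by rewrite (gen _ jN) coord_form_bracket// mulr1 mulr0 subr0.
- rewrite (gen _ iN) lie_antisym coord_formN coord_form_bracket//.
  by rewrite mul0r mul1r sub0r.
- by rewrite (gen _ iN) (gen _ jN) lie_alternating coord_form0 mul0r mulr0 subr0.
Qed.

(** With [Y] the flow field, equation [i] reads [Y_i dF(d) - [i = last] dF(Y) = 0], [d] being the
    last unit vector. The first one gives [dF(d) = 0] as [Y_1 = lambda x_1] is non-zero; the last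
    one then gives [dF(Y) = 0]. *)
Lemma invariant_eqs (F : 'rV[C]_n.+1 -> C) x :
  lambda != 0 -> xcoord x 1 != 0 -> differentiable F x ->
  (forall i : 'I_n.+1, \sum_j \sum_k structure_const L e i j k * x 0 k
        * 'D_(delta_mx 0 j) F x = 0) <->
  'd F x (delta_mx 0 ord_max) = 0 /\ 'd F x (flow_field lambda x) = 0.
Proof.
move=> l0 x1 Fd.
pose Y := flow_field lambda x.
have dE (v : 'rV[C]_n.+1) : 'd F x v = \sum_j v 0 j * 'D_(delta_mx 0 j) F x.
  rewrite {1}[v]row_sum_delta linear_sum; apply: eq_bigr => j _.
  by rewrite linearZ deriveE.
have sE i : \sum_j \sum_k structure_const L e i j k * x 0 k * 'D_(delta_mx 0 j) F x
    = Y 0 i * 'd F x (delta_mx 0 ord_max) - (i == ord_max)%:R * 'd F x Y.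
  rewrite !dE !mulr_sumr -sumrB; apply: eq_bigr => j _.
  rewrite -mulr_suml !mulrA -mulrBl; congr (_ * _).
  have /matrixP /(_ i j) := structure_mxE x.
  by rewrite !mxE !big_ord1 !mxE eqxx.
split=> [H|[H1 H2] i]; last by rewrite sE H1 H2 !mulr0 subrr.
have Y0 : Y 0 ord0 != 0.
  by rewrite mxE /= (leq_trans _ n2)// addr0 mulf_neq0.
have E0 : ord0 == ord_max :> 'I_n.+1 = false by rewrite -val_eqE /=; lia.
have := H ord0; rewrite sE E0 mul0r subr0 => /eqP; rewrite mulf_eq0 (negbTE Y0) /= => /eqP H1.
split=> //; have := H ord_max; rewrite sE H1 mulr0 eqxx mul1r sub0r => /eqP.
by rewrite oppr_eq0 => /eqP.
Qed.

(** The structure matrix is a difference of two matrices of rank at most 1, and rank 2 is attained;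
    the dimension is [n.+1]. *)
Lemma num_invariantsJ : lambda != 0 -> num_invariants L e = n.-1.
Proof.
move=> l0; rewrite /num_invariants.
have rk x : (\rank (structure_mx L e x) <= 2)%N.
  rewrite structure_mxE; apply: leq_trans (mxrank_add _ _) _.
  rewrite mxrank_opp; apply: (@leq_add _ _ 1 1).
    by apply: leq_trans (mxrankM_maxr _ _) (rank_leq_row _).
  by apply: leq_trans (mxrankM_maxr _ _) (rank_leq_row _).
(* At the first unit vector the field [Y] starts with [lambda], so it is independent of the last
   unit vector [d]. *)
pose x0 : 'rV[C]_n.+1 := delta_mx 0 0.
pose d : 'rV[C]_n.+1 := delta_mx 0 ord_max.
pose Y := flow_field lambda x0.
have E0 : ord0 == ord_max :> 'I_n.+1 = false by rewrite -val_eqE /=; lia.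
have Y0 : Y 0 ord0 = lambda.
  rewrite mxE /= (leq_trans _ n2)// addr0 (@xcoordS _ _ _ ord0) mxE eqxx mulr1//.
have dr : \rank d = 1%N by rewrite mxrank_delta.
have sM i : row i (structure_mx L e x0) = Y 0 i *: d - (i == ord_max)%:R *: Y.
  rewrite structure_mxE; apply/rowP => j; rewrite !mxE !big_ord1 !mxE.
  by rewrite eqxx.
have dM : (d <= structure_mx L e x0)%MS.
  have := row_sub ord0 (structure_mx L e x0).
  by rewrite sM E0 scale0r subr0 Y0 (eqmx_scale _ l0).
have YM : (Y <= structure_mx L e x0)%MS.
  have := row_sub ord_max (structure_mx L e x0).
  rewrite sM eqxx scale1r => H.
  rewrite -[Y](subKr (Y 0 ord_max *: d)) addmx_sub ?scalemx_sub//.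
  by rewrite -scaleN1r scalemx_sub.
have r2 : \rank (structure_mx L e x0) = 2%N.
  (* In rank at most 1 the row space would be the line of [d], making [Y] a multiple of [d], whose
     first entry is 0. *)
  apply/eqP; rewrite eqn_leq rk /= ltnNge; apply/negP => r1.
  have [_] := mxrank_leqif_sup dM.
  rewrite dr eqn_leq r1 andbT -{1}dr mxrankS// => /esym Md.
  have /sub_rVP[a Ya] := submx_trans YM Md.
  by move: l0; rewrite -Y0 Ya !mxE E0 andbF mulr0 eqxx.
have -> : (\max_(r < n.+2 | `[< exists x, \rank (structure_mx L e x) = r >]) r = 2)%N.
  apply/eqP; rewrite eqn_leq; apply/andP; split.
    by apply/bigmax_leqP => r /asboolP[x <-].
  have r3 : (2 < n.+2)%N by lia.
  apply: (@bigop.leq_bigmax_cond _ (fun r : 'I_n.+2 =>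
      `[< exists x, \rank (structure_mx L e x) = r >]) (fun r => r : nat) (Ordinal r3)).
  by apply/asboolP; exists x0.
by rewrite subn2.
Qed.

End Structure.

(** * The zetas along the flow, and the normal form of an orbit *)

Section Zeta.
Variables (R : realType) (n : nat) (lambda : CC R).
Local Open Scope complex_scope.
Local Notation C := (CC R).
Hypothesis n2 : (2 <= n)%N.
Implicit Types (x : 'rV[C]_n.+1) (z : 'rV[C]_(n.+1 - 2)).

Definition slope x : C := xcoord x 2 / xcoord x 1.

Definition zeta_map x : 'rV[C]_(n.+1 - 2) := \row_i zetas lambda i x.

(** Dividing by [xi_1^k] turns the monomials in [x_1] and [x_2] into powers of the slope over [x_1]:
    the coordinate of the orbit point of slope 0, up to a scalar which division by [x_1] removes. *)
Lemma zetaE k x : (2 <= k)%N -> xcoord x 1 != 0 ->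
  zeta lambda k.+1 x =
    (xcoord x 1)^-1 * texp (- slope x) (fun j => xcoord x j.+1) k.
Proof.
move=> k2 x1; rewrite /zeta /xi eqSS (gtn_eqF (ltnW k2)) eqxx /=.
rewrite big_add1 /= big_mkord /texp mulr_suml mulr_sumr; apply: eq_bigr => j _.
have jk : (j <= k)%N by rewrite -ltnS.
rewrite subSS /slope.
have -> : (j.+1%:Z - 2 = j%:Z + (- 1))%R by rewrite -addn1 PoszD; ring.
rewrite expfzDr// -exprnP exprN1.
rewrite (exprNn (_ / _)) expr_div_n; set a := xcoord x 1 in x1 *.
have -> : a ^+ k = a ^+ j * a ^+ (k - j) by rewrite -exprD subnKC.
have F : (((k - j)`!)%:R : C) != 0 by rewrite pnatr_eq0 -lt0n fact_gt0.
have A m : a ^+ m != 0 by rewrite expf_neq0.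
by field; rewrite F x1 !A.
Qed.

Lemma xcoord_flow1 s u x : xcoord (flow lambda s u x) 1 = expC (lambda * s) * xcoord x 1.
Proof.
rewrite xcoord_flow ?(leq_trans _ n2)//.
by rewrite /texp big_ord_recr big_ord0 /= expr0 divr1 mul1r add0r.
Qed.

Lemma xcoord_flow1_neq0 s u x : xcoord x 1 != 0 -> xcoord (flow lambda s u x) 1 != 0.
Proof. by move=> x1; rewrite xcoord_flow1 mulf_neq0 ?expC_neq0. Qed.

Lemma slope_flow s u x : xcoord x 1 != 0 -> slope (flow lambda s u x) = slope x + s.
Proof.
move=> x1; rewrite /slope xcoord_flow1 xcoord_flow//.
rewrite /texp !big_ord_recr big_ord0 /= subn0 expr1 expr0 fact0 factS fact0 muln1 !divr1.
by field; rewrite x1 expC_neq0.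
Qed.

(** The slope grows by [s], so the shift by [- slope x - s] undoes the shift by [s]; the factor
    [expC (lambda * s)] cancels against that of [x_1]. *)
Lemma zeta_flow k s u x : (2 <= k < n)%N -> xcoord x 1 != 0 ->
  zeta lambda k.+1 (flow lambda s u x) = zeta lambda k.+1 x.
Proof.
move=> /andP[k2 kn] x1; rewrite !zetaE ?xcoord_flow1_neq0// slope_flow//.
rewrite (@eq_texp _ _ _ (fun j => expC (lambda * s) *
  texp s (fun j => xcoord x j.+1) j)); last first.
  by move=> j jk; rewrite xcoord_flow// (leq_ltn_trans jk).
rewrite texpZ texpD opprD subrK xcoord_flow1 invfM.
by field; rewrite x1 expC_neq0.
Qed.

Lemma zeta1_flow s u x : xcoord x 1 != 0 ->
  zeta lambda 1 (flow lambda s u x) = zeta lambda 1 x.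
Proof.
move=> x1; rewrite /zeta eqxx -!/(slope _) slope_flow// xcoord_flow1.
rewrite mulrDr expCD -[RHS]mulr1 mulrAC.
have -> : 1 = expC (lambda * s) * expC (- lambda * s) :> C.
  by rewrite -expCD mulNr subrr expC0.
by ring.
Qed.

Lemma zetas_flow i s u x : xcoord x 1 != 0 ->
  zetas lambda i (flow lambda s u x) = zetas lambda i x.
Proof.
move=> x1; rewrite /zetas; case: ifPn => [_|i0]; first exact: zeta1_flow.
by apply: zeta_flow => //; have := ltn_ord i; lia.
Qed.

(* The point with zeta-values z where x_2 = 0; its last coordinate is junk,
   overwritten by the flow. *)
Definition normal_form z : 'rV[C]_n.+1 :=
  \row_k if k == 0%N :> nat then xcoord z 1
         else if k == 1%N :> nat then 0 else xcoord z 1 * xcoord z k.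

Lemma xcoord_normal_form z k : (k < n.+1)%N -> xcoord (normal_form z) k.+1 =
  if k == 0%N then xcoord z 1 else if k == 1%N then 0 else xcoord z 1 * xcoord z k.
Proof. by move=> kn; rewrite (@xcoordS _ _ _ (Ordinal kn)) mxE. Qed.

(** At slope 0 the shift is the identity. There is no [zeta_2], so for [i > 0] entry [i] is
    [zeta_(i+2)], read off the coordinate of 0-based index [i + 1]. *)
Lemma zetas_normal_form i z : xcoord z 1 != 0 -> zetas lambda i (normal_form z) = z 0 i.
Proof.
move=> z1; have N1 : xcoord (normal_form z) 1 = xcoord z 1 by rewrite xcoord_normal_form.
have N2 : slope (normal_form z) = 0.
  by rewrite /slope (@xcoord_normal_form z 1) ?mul0r//; lia.
rewrite /zetas; case: ifPn => [/eqP i0|i0].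
  rewrite /zeta eqxx -/(slope _) N1 N2 mulr0 expC0 mulr1.
  by rewrite -xcoordS i0.
rewrite zetaE ?N1//; last by rewrite ltnS lt0n.
rewrite N2 oppr0 texp0 xcoord_normal_form /=; last by have := ltn_ord i; lia.
by rewrite eqSS (negbTE i0) mulKf// xcoordS.
Qed.

(** Up to the last coordinate, the normal form of the zeta values of [x] is [x] flowed for time
    [- slope x]; the group law does the rest. *)
Lemma flow_normal_form s u x : xcoord x 1 != 0 ->
  flow lambda s u (normal_form (zeta_map x)) = flow lambda (s - slope x) u x.
Proof.
move=> x1; rewrite -(flowD lambda s (- slope x) u 0); apply: eq_flow => k /= kn.
rewrite xcoord_normal_form; last by lia.
rewrite xcoord_flow//.
have i0 : (0 < n.+1 - 2)%N by lia.
have Z1 : xcoord (zeta_map x) 1 = xcoord x 1 * expC (lambda * - slope x).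
  by rewrite (@xcoordS _ _ _ (Ordinal i0)) mxE /zetas /zeta /= mulrN mulNr.
case: k kn => [|[|k]] kn /=.
- rewrite Z1 /texp big_ord_recr big_ord0 /= expr0 divr1 mul1r add0r mulrC//.
- rewrite /texp !big_ord_recr big_ord0 /= subn0 expr1 expr0 factS fact0 muln1 !divr1.
  by rewrite /slope; field.
- have ik : (k.+1 < n.+1 - 2)%N by lia.
  rewrite Z1 (@xcoordS _ _ (zeta_map x) (Ordinal ik)) mxE /zetas /= zetaE//.
  by field.
Qed.

Lemma differentiable_normal_form z : differentiable normal_form z.
Proof.
apply: differentiable_row => k; case: (nat_of_ord k == 0%N).
  exact: differentiable_xcoord.
case: (nat_of_ord k == 1%N); first exact: differentiable_cst.
by apply: differentiableM; exact: differentiable_xcoord.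
Qed.

Lemma differentiable_slope x : xcoord x 1 != 0 -> differentiable slope x.
Proof.
move=> x1; apply: differentiableM; first exact: differentiable_xcoord.
by apply: differentiableV => //; exact: differentiable_xcoord.
Qed.

Lemma differentiable_zetas i x : xcoord x 1 != 0 -> differentiable (zetas lambda i) x.
Proof.
move=> x1; rewrite /zetas; case: ifPn => [_|i0].
  apply: differentiableM; first exact: differentiable_xcoord.
  apply: (@differentiable_comp _ _ _ _ (fun y => - lambda * slope y) (@expC R : C -> C)).
    by apply: differentiableM => //; exact: differentiable_slope.
  exact: differentiable_expC.
rewrite /zeta eqSS /=.
apply: differentiableM; last first.
  apply: differentiableV; last by rewrite /xi expf_neq0.
  by apply: differentiable_exp; exact: differentiable_xcoord.
have -> : xi i.+2 = \sum_(j < i.+2) (fun x => (-1) ^+ (i.+1 - j) / ((i.+1 - j)`!)%:R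
    * xcoord x 1 ^ (j.+1%:Z - 2) * xcoord x 2 ^+ (i.+1 - j) * xcoord x j.+1).
  apply/funext => y; rewrite fct_sumE /xi eqSS /= big_add1 big_mkord.
  by apply: eq_bigr => j _; rewrite subSS.
apply: differentiable_sum => j.
apply: differentiableM; last exact: differentiable_xcoord.
apply: differentiableM; last by apply: differentiable_exp; exact: differentiable_xcoord.
apply: differentiableM; first exact: differentiable_cst.
(* The exponent is [-1] in the first summand, where [x_1] is inverted, and a natural number in all
   others. *)
case: (nat_of_ord j) => [|m].
  have -> : (1%:Z - 2 = - 1)%R by [].
  under eq_fun do rewrite exprN1.
  by apply: differentiableV => //; exact: differentiable_xcoord.
have -> : (m.+2%:Z - 2 = m%:Z)%R by rewrite -addn2 PoszD addrK.
by under eq_fun do rewrite -exprnP; apply: differentiable_exp; exact: differentiable_xcoord.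
Qed.

End Zeta.

(** * Invariance, independence and completeness of the zetas *)

Section Main.
Variables (R : realType) (n : nat) (lambda : CC R).
Local Open Scope complex_scope.
Local Notation C := (CC R).
Hypothesis n2 : (2 <= n)%N.
Local Notation U := [set x : 'rV[C]_n.+1 | xcoord x 1 != 0].

Lemma flow0 (x : 'rV[C]_n.+1) : flow lambda 0 (x 0 ord_max) x = x.
Proof.
apply/rowP => k; rewrite mxE mulr0 expC0 mul1r texp0 /= xcoordS.
case: ifPn => //; rewrite -leqNgt => nk; congr (x 0 _).
by apply/val_inj => /=; have := ltn_ord k; lia.
Qed.

Lemma open_xcoord_neq0 m k : open [set x : 'rV[C]_m | xcoord x k != 0].
Proof.
have -> : [set x : 'rV[C]_m | xcoord x k != 0] =
    (fun x => xcoord x k) @^-1` (~` [set (0 : C)]).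
  by apply/seteqP; split => x /= /eqP.
apply: open_comp.
  by move=> x _; apply: differentiable_continuous; exact: differentiable_xcoord.
apply: closed_openC; apply: accessible_closed_set1; apply: hausdorff_accessible.
exact: norm_hausdorff.
Qed.

Lemma xcoord1E (x : 'rV[C]_n.+1) : xcoord x 1 = x 0 0.
Proof. by rewrite (@xcoordS _ _ _ ord0). Qed.

(** The exponential maps onto the non-zero numbers, so the domain is the continuous image of the
    whole space under [expC] in the first coordinate. *)
Lemma connected_domain : connected U.
Proof.
pose f (x : 'rV[C]_n.+1) : 'rV[C]_n.+1 :=
  \row_(k < n.+1) if k == 0 then expC (x 0 k) else x 0 k.
have -> : U = f @` setT.
  apply/seteqP; split => [x /= x1|_ [x _ <-]] /=; last first.
    by rewrite xcoord1E mxE eqxx expC_neq0.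
  have [z zx] := expC_surj x1.
  exists (\row_k if k == 0 then z else x 0 k) => //.
  apply/rowP => k; rewrite !mxE; case: eqP => // ->.
  by rewrite zx xcoord1E.
apply: connected_continuous_connected; first exact: connected_rV.
apply: continuous_subspaceT => x; apply: differentiable_continuous.
apply: differentiable_row => k; case: (k == 0); last exact: differentiable_coord.
apply: (@differentiable_comp _ _ _ _ (fun x : 'rV[C]_n.+1 => x 0 k) (@expC R : C -> C)).
  exact: differentiable_coord.
exact: differentiable_expC.
Qed.

Lemma domain_neq0 : U !=set0.
Proof. by exists (delta_mx 0 0); rewrite /= xcoord1E mxE eqxx oner_eq0. Qed.

Variables (V : vectType C) (L : lieAlgebra V) (e : n.+1.-tuple V).
Hypotheses (l0 : lambda != 0) (eJ : J_basis lambda L e).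

Lemma zetas_invariant (i : 'I_(n.+1 - 2)) : invariant_on L e U (zetas lambda i).
Proof.
split.
- exact: open_xcoord_neq0.
- exact: connected_domain.
- exact: domain_neq0.
- by move=> x; exact: differentiable_zetas.
move=> x x1.
have Fd : differentiable (zetas lambda i) x by exact: differentiable_zetas.
(* The zetas are constant along the curves of [is_derive_flow], which pass through [x] at time 0;
   the two unit choices of [(h, w)] give the two invariance equations. *)
have D h w : 'd (zetas lambda i) x (h *: flow_field lambda x + w *: delta_mx 0 ord_max) = 0.
  have [gd gE] := is_derive_flow lambda h (x 0 ord_max) w x 0.
  rewrite mul0r mul0r addr0 flow0 in gE.
  have g0 : flow lambda (0 * h) (x 0 ord_max + 0 * w) x = x.
    by rewrite !mul0r addr0 flow0.
  have Fd' : differentiable (zetas lambda i)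
      (flow lambda (0 * h) (x 0 ord_max + 0 * w) x) by rewrite g0.
  have [_] := derive_curve gd Fd'.
  rewrite gE g0 => <-.
  have -> : zetas lambda i \o (fun z => flow lambda (z * h) (x 0 ord_max + z * w) x)
      = cst (zetas lambda i x).
    by apply/funext => z /=; rewrite zetas_flow.
  exact: derive_cst.
apply/(invariant_eqs n2 eJ l0 x1 Fd); split.
  by have := D 0 1; rewrite scale0r scale1r add0r.
by have := D 1 0; rewrite scale0r scale1r addr0.
Qed.

(** Slope and last coordinate are frozen at those of [p], so that the section passes through [p]
    when [x_1] is non-zero there. *)
Definition zeta_section (p : 'rV[C]_n.+1) (z : 'rV[C]_(n.+1 - 2)) : 'rV[C]_n.+1 :=
  flow lambda (slope p) (p 0 ord_max) (normal_form z).

Lemma zeta_sectionK p z : xcoord z 1 != 0 -> zeta_map lambda (zeta_section p z) = z.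
Proof.
move=> z1; apply/rowP => i; rewrite mxE zetas_flow ?zetas_normal_form//.
by rewrite xcoord_normal_form.
Qed.

Lemma zeta_section_zeta_map p (x : 'rV[C]_n.+1) : xcoord x 1 != 0 ->
  zeta_section p (zeta_map lambda x) =
    flow lambda (slope p - slope x) (p 0 ord_max) x.
Proof. exact: flow_normal_form. Qed.

Lemma differentiable_zeta_section p z : differentiable (zeta_section p) z.
Proof.
apply: (differentiable_flow lambda (differentiable_cst _ _) (differentiable_cst _ _)).
exact: differentiable_normal_form.
Qed.

Lemma open_zeta_section p (A : set 'rV[C]_n.+1) : open A -> open (zeta_section p @^-1` A).
Proof.
move=> oA; apply: open_comp => // z _.
by apply: differentiable_continuous; exact: differentiable_zeta_section.
Qed.

Lemma xcoord_zeta_map (x : 'rV[C]_n.+1) : xcoord x 1 != 0 -> xcoord (zeta_map lambda x) 1 != 0.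
Proof.
move=> x1; have i0 : (0 < n.+1 - 2)%N by lia.
by rewrite (@xcoordS _ _ _ (Ordinal i0)) mxE /zetas /zeta /= mulf_neq0// expC_neq0.
Qed.

Lemma zetas_independent : functionally_independent U (@zetas R lambda n.+1).
Proof.
move=> A oA [p Ap] AU [W [H [_ _ Hnz HA]]].
(* Each [z] in this open set is the zeta value of a point of [A], namely of [zeta_section p z], so
   [H] vanishes on it. *)
pose W' := (zeta_section p @^-1` A) `&` [set z | xcoord z 1 != 0].
have oW' : open W'.
  by apply: openI; [exact: open_zeta_section | exact: open_xcoord_neq0].
have p1 : xcoord p 1 != 0 by exact: AU.
have W'W z : W' z -> W z /\ H z = 0.
  by move=> [Az z1]; have := HA _ Az; rewrite -/(@zeta_map R n lambda _) zeta_sectionK.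
have W'p : W' (zeta_map lambda p).
  split; last exact: xcoord_zeta_map.
  by rewrite /= zeta_section_zeta_map// subrr flow0.
have [||z W'z] := Hnz W' oW'.
- by exists (zeta_map lambda p).
- by move=> z /W'W[].
- by have [_ ->] := W'W _ W'z; rewrite eqxx.
Qed.

(** Along the path, time and last coordinate vary linearly; its velocity combines the two vectors
    killed by ['d F], so [F] has derivative 0 on it. *)
Lemma invariant_flow (U' : set 'rV[C]_n.+1) (F : 'rV[C]_n.+1 -> C) (s u : C) x :
  invariant_on L e U' F -> xcoord x 1 != 0 ->
  (forall r : R, 0 <= r <= 1 ->
     U' (flow lambda (r%:C * s) (x 0 ord_max + r%:C * (u - x 0 ord_max)) x)) ->
  F (flow lambda s u x) = F x.
Proof.
move=> [_ _ _ Fh FI] x1 pU.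
pose g (z : C) := flow lambda (z * s) (x 0 ord_max + z * (u - x 0 ord_max)) x.
have := @complex_derive0_eq01 R (F \o g).
rewrite /g /= !mul1r subrKC !mul0r addr0 flow0; apply => r r01.
have [gd gE] := is_derive_flow lambda s (x 0 ord_max) (u - x 0 ord_max) x r%:C.
have Ur := pU _ r01.
have Fd := Fh _ Ur.
apply: is_derive_eq; first exact: (derive_curve gd Fd).
have [||d1 d2] := (invariant_eqs n2 eJ l0 _ Fd).1; first exact: xcoord_flow1_neq0.
  exact: FI.
by rewrite gE linearD !linearZ /= d1 d2 !scaler0 addr0.
Qed.

Lemma invariant_locally_function (U' : set 'rV[C]_n.+1) (F : 'rV[C]_n.+1 -> C) p :
  invariant_on L e U' F -> U p -> U' p ->
  locally_function_of (@zetas R lambda n.+1) F p.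
Proof.
move=> FI p1 U'p; have [oU' _ _ Fh _] := FI.
(* Joint continuity in time, last coordinate and starting point keeps all short paths that start
   near [p] inside [U']. *)
pose Gam (t : C * C * 'rV[C]_n.+1) := flow lambda t.1.1 t.1.2 t.2.
have Gc : {for (0, p 0 ord_max, p), continuous Gam}.
  apply: differentiable_continuous.
  have fst_diff (W1 W2 : normedModType C) (w : W1 * W2) : differentiable fst w.
    by apply: linear_differentiable => w'; exact: cvg_fst.
  have snd_diff (W1 W2 : normedModType C) (w : W1 * W2) : differentiable snd w.
    by apply: linear_differentiable => w'; exact: cvg_snd.
  apply: differentiable_flow => //.
    by apply: (@differentiable_comp _ _ _ _ fst fst).
  by apply: (@differentiable_comp _ _ _ _ fst snd).
have : nbhs (0 : C, p 0 ord_max, p) (Gam @^-1` U').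
  apply: Gc; rewrite /Gam /= flow0; exact: (@open_nbhs_nbhs _ p U' (conj oU' U'p)).
move=> [[P Q] /= [[[P1 P2] /= [P1n P2n] P12] Qn] PQ].
have /nbhs_ballP[d1 /= d10 B1] := P1n.
have /nbhs_ballP[d2 /= d20 B2] := P2n.
(* For [x] in [A] the parameters of the whole path from [x] to [zeta_section p (zeta_map lambda x)]
   stay in the balls of radius [d1] about 0 and [d2] about the last coordinate of [p]. *)
pose A := [set x | [/\ xcoord x 1 != 0, Q x, `|slope p - slope x| < d1 &
  `|p 0 ord_max - x 0 ord_max| < d2]].
have Ap : nbhs p A.
  have N1 : \forall x \near p, xcoord x 1 != 0.
    by apply: open_nbhs_nbhs; split=> //; exact: open_xcoord_neq0.
  have N2 : \forall x \near p, `|slope p - slope x| < d1.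
    have /differentiable_continuous/cvgrPdist_lt := differentiable_slope p1.
    by apply.
  have N3 : nbhs p (fun x : 'rV[C]_n.+1 => `|p 0 ord_max - x 0 ord_max| < d2).
    have /differentiable_continuous/cvgrPdist_lt := differentiable_coord p 0 ord_max.
    by apply.
  by near=> x; split; near: x.
have path x r : A x -> 0 <= r <= 1 -> U' (flow lambda (r%:C * (slope p - slope x))
    (x 0 ord_max + r%:C * (p 0 ord_max - x 0 ord_max)) x).
  move=> [x1 Qx xd1 xd2] /andP[r0 r1].
  have b1 : `|0 - (r%:C : C) * (slope p - slope x)| < d1.
    rewrite sub0r normrN normrM.
    by apply: le_lt_trans xd1; rewrite ler_piMl// ger0_norm ?lecR.
  have b2 : `|p 0 ord_max - (x 0 ord_max + (r%:C : C) * (p 0 ord_max - x 0 ord_max))| < d2.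
    have -> : p 0 ord_max - (x 0 ord_max + (r%:C : C) * (p 0 ord_max - x 0 ord_max)) =
        (1 - r)%:C * (p 0 ord_max - x 0 ord_max).
      by rewrite (rmorphB (real_complex R)); ring.
    rewrite normrM; apply: le_lt_trans xd2; rewrite ler_piMl// ger0_norm ?lecR.
      by rewrite lerBlDr lerDl.
    by rewrite subr_ge0.
  exact: (PQ (_, _, x) (conj (P12 (_, _) (conj (B1 _ b1) (B2 _ b2))) Qx)).
exists A°, (zeta_section p @^-1` U'), (F \o zeta_section p); split.
- exact: open_interior.
- exact: Ap.
- exact: open_zeta_section.
- move=> z U'z; apply: differentiable_comp; first exact: differentiable_zeta_section.
  exact: Fh.
move=> x /interior_subset Ax; have [x1 _ _ _] := Ax.
rewrite -/(@zeta_map R n lambda _) /= zeta_section_zeta_map//; split.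
  have := path x 1 Ax; rewrite !mul1r subrKC; apply.
  by rewrite ler01 lexx.
by rewrite (invariant_flow FI)// => r r01; exact: path.
Unshelve. all: by end_near. Qed.

End Main.

Theorem mainTheorem2 (R : realType) (n : nat) (lambda : CC R)
    (V : vectType (CC R)) (L : lieAlgebra V) (e : n.-tuple V) :
  (3 <= n)%N -> lambda != 0 -> J_basis lambda L e ->
  basis_of_invariants L e [set x : 'rV[CC R]_n | xcoord x 1 != 0]
    (@zetas R lambda n).
Proof.
(* From here the dimension is [n.+1], and [3 <= n.+1] serves as [2 <= n]. *)
case: n e => // n e n2 l0 eJ; split.
- exact: zetas_invariant.
- exact: zetas_independent.
- by rewrite (num_invariantsJ n2 eJ l0) subSS subn1.
- by move=> U' G GI p Up U'p; apply: invariant_locally_function GI Up U'p.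
Qed.
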